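(* For every finite sequence $I=(a_1,a_2,\ldots,a_n)$ of positive integers, the conjugation $\chi_{\mathcal{F}_2^*}$ of the mod $2$ dual Leibniz--Hopf algebra $\mathcal{F}_2^*$ satisfies $$\chi_{\mathcal{F}_2^*}(S_I)=\sum_{\beta\in \mathcal{P}(I)}\ \prod_{k=1}^{l(\beta)} S_{\beta(k)},$$ where $\mathcal{P}(I)$ is the set of ordered block partitions of $I$ and the products are taken in $\mathcal{F}_2^*$.
   Context: Let $\mathcal{F}_2$ be the free associative unital algebra over $\mathbb{F}_2$ on generators $S^1,S^2,S^3,\ldots$ with degree $|S^i|=i$, and put $S^0=1$. It is a graded connected Hopf algebra with the co-commutative co-product $\Delta(S^n)=\sum_{i=0}^n S^i\otimes S^{n-i}$ (the mod $2$ Leibniz--Hopf algebra). It has the $\mathbb{F}_2$-basis $S^I=S^{i_1}\cdots S^{i_n}$, where $I=(i_1,\ldots,i_n)$ runs over all finite sequences of positive integers ($n\ge 0$; $S^{()}=1$). $\mathcal{F}_2^*$ denotes the graded dual Hopf algebra, with dual basis $S_I$, so $\langle S^{I'},S_I\rangle=1$ if $I=I'$ and $0$ otherwise. We write $S_{a_1,\ldots,a_n}$ for $S_{(a_1,\ldots,a_n)}$. Its commutative product is dual to $\Delta$, i.e. $\langle S_IS_J,S^K\rangle=\langle S_I\otimes S_J,\Delta(S^K)\rangle$. Its co-product is $\Delta(S_{a_1,\ldots,a_n})=\sum_{i=0}^{n}S_{a_1,\ldots,a_i}\otimes S_{a_{i+1},\ldots,a_n}$, where the basis element indexed by the empty sequence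 is the unit $1$. The conjugation (antipode) $\chi$ of a connected commutative or co-commutative Hopf algebra is the unique linear map with $\chi(1)=1$ and $\sum x'\chi(x'')=0$ whenever $\deg(x)>0$ and $\Delta(x)=\sum x'\otimes x''$. Ordered block partitions: $\mathcal{P}(a_1,\ldots,a_n)$ is the set of all $$\beta=\big((a_1,\ldots,a_{i_1})\,|\,(a_{i_1+1},\ldots,a_{i_2})\,|\,\ldots\,|\,(a_{i_{l-1}+1},\ldots,a_{i_l})\big),\qquad 1\le i_1<i_2<\cdots<i_l=n,$$ i.e. all ways of cutting the sequence into consecutive non-empty blocks (elements of $\mathcal{P}$ are indexed by the cut positions $i_1<\cdots<i_l$). Put $l(\beta)=l$ and $\beta(k)=(a_{i_{k-1}+1},\ldots,a_{i_k})$ with $i_0=0$. For the empty sequence, $\mathcal{P}$ consists of the single empty partition with $l=0$, whose product is $1$. *)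

(* Defs.v *)
From HB Require Import structures.
From mathcomp Require Import all_boot all_algebra finmap monalg.

Set Implicit Arguments.
Unset Strict Implicit.
Unset Printing Implicit Defensive.

Import GRing.Theory.
Local Open Scope ring_scope.

(* Linear extension of a function on the basis K of the free module {malg R[K]}. *)
Definition linext (R : comNzRingType) (K : choiceType) (V : lmodType R) (h : K -> V)
  (x : {malg R[K]}) : V := \sum_(k <- msupp x) x@_k *: h k.

Section LinextTheory.
Variables (R : comNzRingType) (K : choiceType) (V : lmodType R).
Implicit Types (h : K -> V) (x y : {malg R[K]}).

Lemma linextEw h (d : {fset K}) x :
  (msupp x `<=` d)%fset -> linext h x = \sum_(k <- d) x@_k *: h k.
Proof.
move=> le; rewrite /linext; apply: (big_fset_incl _ le) => k _ /mcoeff_outdom ->.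
by rewrite scale0r.
Qed.

Lemma linext_is_linear h : linear (linext h).
Proof.
move=> a x y; set d := (msupp x `|` msupp y)%fset.
have lx : (msupp x `<=` d)%fset by apply: fsubsetUl.
have ly : (msupp y `<=` d)%fset by apply: fsubsetUr.
have lxy : (msupp (a *: x + y) `<=` d)%fset.
  apply: fsubset_trans (msuppD_le _ _) _; rewrite fsubUset ly andbT.
  exact: fsubset_trans (msuppZ_le _ _) lx.
rewrite (linextEw _ lx) (linextEw _ ly) (linextEw _ lxy) scaler_sumr -big_split.
by apply: eq_bigr => k _ /=; rewrite mcoeffD mcoeffZ scalerDl scalerA.
Qed.

HB.instance Definition _ h :=
  GRing.isLinear.Build R {malg R[K]} V *:%R (linext h) (linext_is_linear h).

Lemma linext0 h : linext h 0 = 0. Proof. exact: linear0. Qed.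
Lemma linextP h a x y : linext h (a *: x + y) = a *: linext h x + linext h y.
Proof. exact: linearP. Qed.
Lemma linextZ h a x : linext h (a *: x) = a *: linext h x.
Proof. exact: linearZ. Qed.
Lemma linext_sum h (T : Type) (s : seq T) (F : T -> {malg R[K]}) :
  linext h (\sum_(i <- s) F i) = \sum_(i <- s) linext h (F i).
Proof. exact: linear_sum. Qed.

Lemma linextU h k : linext h << k >> = h k.
Proof. by rewrite /linext msuppU oner_eq0 big_seq_fset1 mcoeffUU scale1r. Qed.

End LinextTheory.

Lemma mcoeff_linext (R : comNzRingType) (K N : choiceType) (h : K -> {malg R[N]}) x n :
  (linext h x)@_n = \sum_(k <- msupp x) x@_k * (h k)@_n.
Proof.
by rewrite /linext raddf_sum; apply: eq_bigr => k _ /=; rewrite mcoeffZ.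
Qed.

Lemma malg_ind2 (R : comNzRingType) (K : choiceType) (P : {malg R[K]} -> Prop) :
  P 0 -> (forall a x y, P x -> P y -> P (a *: x + y)) -> (forall k, P << k >>) ->
  forall x, P x.
Proof.
move=> P0 PD PU x; rewrite [x]monalgE; elim/big_rec: _ => // k y _ Py.
suff -> : << x@_k *g k >> = x@_k *: << k >> by apply: PD.
by apply/malgP => l; rewrite mcoeffZ !mcoeffU mulrnAr mulr1.
Qed.

(* The monoid algebra of M * N is the tensor product of those of M and N, with
   << (m, n) >> standing for << m >> \otimes << n >>. *)
Section ProdMonom.
Variables M N : monomType.
Definition pmone : M * N := (mone, mone).
Definition pmmul (p q : M * N) : M * N := (mmul p.1 q.1, mmul p.2 q.2).
Fact pmmulA : associative pmmul.
Proof. by move=> p q r; rewrite /pmmul !mulmA. Qed.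
Fact pmmul1m : left_id pmone pmmul.
Proof. by case=> m n; rewrite /pmmul !mul1m. Qed.
Fact pmmulm1 : right_id pmone pmmul.
Proof. by case=> m n; rewrite /pmmul !mulm1. Qed.
Fact pmunitm p q : pmmul p q = pmone -> p = pmone /\ q = pmone.
Proof. by case: p q => [a b] [c d] [/unitm[-> ->] /unitm[-> ->]]. Qed.
HB.instance Definition _ :=
  Choice_isMonomialDef.Build (M * N)%type pmmulA pmmul1m pmmulm1 pmunitm.
End ProdMonom.
Definition pair_monom (M N : monomType) : monomType := (M * N)%type.

Lemma malg_scaleAr (R : comNzRingType) (M : monomType) (a : R) (x y : {malg R[M]}) : a *: (x * y) = x * (a *: y).
Proof.
have malgC_comm z : a%:MP * z = z * a%:MP.
  rewrite !malgM_def fgmulUg fgmulgU; apply: eq_bigr => k _.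
  by rewrite mul1m mulm1 mulrC.
by rewrite -!mul_malgC mulrA malgC_comm -!mulrA malgC_comm.
Qed.

Lemma malg1U (R : comNzRingType) (M : monomType) : 1 = << mone >> :> {malg R[M]}.
Proof. by []. Qed.

Lemma linextM_gen (R : comNzRingType) (M N : monomType)
    (h h1 h2 : M -> {malg R[N]}) (x y : {malg R[M]}) :
    (forall a b, h (mmul a b) = h1 a * h2 b) ->
  linext h (x * y) = linext h1 x * linext h2 y.
Proof.
move=> hM; elim/malg_ind2: x => [|a x x' IH IH'|k].
- by rewrite mul0r !linext0 mul0r.
- by rewrite mulrDl -scalerAl !linextP IH IH' mulrDl -scalerAl.
elim/malg_ind2: y => [|a y y' IH IH'|l].
- by rewrite mulr0 !linext0 mulr0.
- by rewrite mulrDr -malg_scaleAr !linextP IH IH' mulrDr -malg_scaleAr.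
by rewrite malgM_def fgmulUU mulr1 !linextU hM.
Qed.

Lemma linextM (R : comNzRingType) (M N : monomType) (h : M -> {malg R[N]}) x y :
  (forall a b, h (mmul a b) = h a * h b) ->
  linext h (x * y) = linext h x * linext h y.
Proof. exact: linextM_gen. Qed.

Lemma linext1 (R : comNzRingType) (M N : monomType) (h : M -> {malg R[N]}) :
  h mone = 1 -> linext h 1 = 1.
Proof. by move=> h1; rewrite [in LHS]malg1U linextU. Qed.

Lemma mulUU (R : comNzRingType) (M : monomType) (a b : M) :
  << a >> * << b >> = << mmul a b >> :> {malg R[M]}.
Proof. by rewrite malgM_def fgmulUU mulr1. Qed.

Definition letter := {i : nat | (0 < i)%N}.

Definition word : monomType := {fmonom letter}.

Definition wdeg (I : seq letter) : nat := \sum_(a <- I) val a.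

(* The mod 2 Leibniz--Hopf algebra and its dual are the case R = 'F_2. No sign occurs in
   the product of leibniz_hopf2, so for the grading |S^i| = i this is the tensor
   product of graded algebras only in characteristic 2. *)
Section LeibnizHopf.
Variable R : comNzRingType.

Definition leibniz_hopf := {malg R[word]}.
Definition leibniz_hopf2 := {malg R[pair_monom word word]}.

(* The word of S^n, with S^0 = 1. *)
Definition gen (n : nat) : word := oapp (@fmu letter) mone (insub n).

(* The algebra morphism with S^n |-> \sum_(i <= n) S^i \otimes S^(n - i); see LH_coprodM
   and LH_coprod_gen. *)
Definition LH_coprod : leibniz_hopf -> leibniz_hopf2 :=
  linext (fun K : word =>
    \prod_(a <- (K : seq letter)) \sum_(i < (val a).+1)
      << (gen i, gen (val a - i)) >>).

(* A finite set containing every word of degree at most d: such a word has at most d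
   letters, all at most d, and insub discards the zeros used for padding. *)
Definition words (d : nat) : {fset seq letter} :=
  [fset pmap insub [seq val i | i <- val t] | t in {: d.-tuple 'I_d.+1}]%fset.

Lemma mem_words K d : (wdeg K <= d)%N -> K \in words d.
Proof.
move=> le.
have leK a : a \in K -> (val a < d.+1)%N.
  by move=> aK; rewrite ltnS (leq_trans _ le) // /wdeg (big_rem a) //= leq_addr.
have szK : (size K <= d)%N.
  apply: leq_trans le; rewrite /wdeg -sum1_size; apply: leq_sum => a _.
  exact: valP.
pose s := map (fun a : letter => inord (val a) : 'I_d.+1) K ++ nseq (d - size K) ord0.
have szs : size s == d by rewrite size_cat size_map size_nseq subnKC.
apply/imfsetP; exists (Tuple szs) => //=; rewrite map_cat pmap_cat.
rewrite map_nseq (_ : pmap _ (nseq _ _) = [::]) ?cats0; last first.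
  by elim: (d - size K)%N => //= n ->; rewrite insubF.
elim: K leK {le szK s szs} => //= a K IH leK.
rewrite inordK ?leK ?mem_head // valK /= -IH // => b bK.
by rewrite leK // in_cons bK orbT.
Qed.

Lemma LH_coprodU K : LH_coprod << K >> =
  \prod_(a <- (K : seq letter)) \sum_(i < (val a).+1) << (gen i, gen (val a - i)) >>.
Proof. exact: linextU. Qed.

Lemma gen_deg n : wdeg (gen n) = n.
Proof.
rewrite /gen; case: insubP => /= [a _ <-|].
  by rewrite fmuE /= /wdeg big_seq1.
by rewrite -eqn0Ngt => /eqP ->; rewrite /mone /= fmoneE /wdeg big_nil.
Qed.

Lemma wdegM (K L : word) : wdeg (mmul K L) = (wdeg K + wdeg L)%N.
Proof. by rewrite /mmul /= fmmulE /wdeg /= big_cat. Qed.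

Lemma LH_coprod_deg (K : word) p : p \in msupp (LH_coprod << K >>) ->
  wdeg K = (wdeg p.1 + wdeg p.2)%N.
Proof.
rewrite LH_coprodU; case: K => /= K; elim: K p => [|a K IH] p.
  rewrite big_nil msuppU oner_eq0 in_fset1 => /eqP -> /=.
  by rewrite /mone /= fmoneE /wdeg big_nil.
rewrite big_cons => /msuppM_le [q [r [qin /IH Kr ->]]].
rewrite !wdegM addnACA -Kr [LHS]big_cons; congr (_ + _)%N.
have /existsP [i /eqP ->] : [exists i : 'I_(val a).+1, q == (gen i, gen (val a - i))].
  apply: contraLR qin; rewrite negb_exists => /forallP ne.
  rewrite -mcoeff_eq0 raddf_sum big1 //= => i _.
  by rewrite mcoeffU eq_sym (negbTE (ne i)).
by rewrite /= !gen_deg subnKC // -ltnS.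
Qed.

(* Every homogeneous component of leibniz_hopf is finitely generated, so the elements of
   its graded dual are the finite combinations of the dual basis. A separate type is
   needed because the product is not that of a monoid algebra. *)
Definition LH_dual := {malg R[seq letter]}.
HB.instance Definition _ := GRing.Lmodule.on LH_dual.

Definition dbasis (I : seq letter) : LH_dual := << I >>.

Definition pairing (f : LH_dual) (x : leibniz_hopf) : R :=
  \sum_(K <- msupp x) x@_K * f@_(K : seq letter).
Definition pairing2 (f g : LH_dual) (t : leibniz_hopf2) : R :=
  \sum_(p <- msupp t) t@_p * (f@_(p.1 : seq letter) * g@_(p.2 : seq letter)).

(* S_I S_J, determined by <S_I S_J, S^K> = <S_I \otimes S_J, Delta(S^K)>; the right-hand
   side vanishes unless wdeg K = wdeg I + wdeg J (LH_coprod_deg), so a finite sum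
   suffices. The duality for arbitrary elements is pairing_dmul. *)
Definition dmul_basis (I J : seq letter) : LH_dual :=
  \sum_(K <- words (wdeg I + wdeg J))
     pairing2 (dbasis I) (dbasis J) (LH_coprod << FMonom K >>) *: dbasis K.

Definition dmul (f g : LH_dual) : LH_dual :=
  linext (fun I => linext (dmul_basis I) g) f.

Lemma dual_ext (f g : LH_dual) :
  (forall K : seq letter, f@_(K : seq letter) = g@_(K : seq letter)) -> f = g.
Proof. by move=> fg; apply/malgP. Qed.

Lemma pairing2E f g t :
  pairing2 f g t = linext (V := R^o)
    (fun p : pair_monom word word =>
       f@_(p.1 : seq letter) * g@_(p.2 : seq letter)) t.
Proof. by []. Qed.

Lemma pairing2_basis I J t :
  pairing2 (dbasis I) (dbasis J) t = t@_(FMonom I, FMonom J).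
Proof.
elim/malg_ind2: t => [|a x y IHx IHy|[A B]].
- by rewrite pairing2E linext0 mcoeff0.
- by rewrite pairing2E linextP -!pairing2E IHx IHy mcoeffD mcoeffZ.
rewrite pairing2E linextU !mcoeffU xpair_eqE /= -!val_eqE /= ![_ == fmonom_val _]eq_sym.
by rewrite -mulnb natrM.
Qed.

Lemma mcoeff_dmul_basis I J K :
  (dmul_basis I J)@_K = pairing2 (dbasis I) (dbasis J) (LH_coprod << FMonom K >>).
Proof.
rewrite raddf_sum /=; case: (boolP (K \in words (wdeg I + wdeg J))) => [Kin|Kout].
  rewrite (big_fsetD1 K) //= mcoeffZ mcoeffUU mulr1 big1_fset ?addr0 // => L.
  by rewrite in_fsetD1 => /andP[/negbTE neLK _] _; rewrite mcoeffZ mcoeffU neLK mulr0.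
rewrite big1_fset => [|L Lin _]; last first.
  by rewrite mcoeffZ mcoeffU; case: eqP Kout => [<-|]; rewrite ?Lin ?mulr0.
apply/esym/eqP; rewrite pairing2_basis mcoeff_eq0; apply: contra Kout.
by move=> /LH_coprod_deg /= Kdeg; apply: mem_words; rewrite -Kdeg.
Qed.

Lemma dmulU I J : dmul << I >> << J >> = dmul_basis I J.
Proof. by rewrite /dmul !linextU. Qed.

Lemma dmul0l g : dmul 0 g = 0. Proof. exact: linext0. Qed.
Lemma dmulPl a f f' g : dmul (a *: f + f') g = a *: dmul f g + dmul f' g.
Proof. exact: linextP. Qed.
Lemma dmul0r f : dmul f 0 = 0.
Proof. by rewrite /dmul {1}/linext big1 // => I _; rewrite [linext _ _]linext0 scaler0. Qed.
Lemma dmulPr a f g g' : dmul f (a *: g + g') = a *: dmul f g + dmul f g'.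
Proof.
rewrite /dmul ![linext _ f]/linext scaler_sumr -big_split; apply: eq_bigr => I _ /=.
by rewrite [linext _ (_ + _)]linextP scalerDr !scalerA mulrC.
Qed.

Lemma dmulP f g K :
  (dmul f g)@_(K : seq letter) = pairing2 f g (LH_coprod << FMonom K >>).
Proof.
elim/malg_ind2: f => [|a f f' IH IH'|I].
- rewrite dmul0l mcoeff0 /pairing2 big1 // => p _.
  by rewrite mcoeff0 mul0r mulr0.
- rewrite dmulPl mcoeffD mcoeffZ IH IH' /pairing2 mulr_sumr -big_split.
  apply: eq_bigr => p _ /=; rewrite mcoeffD mcoeffZ mulrDl mulrDr.
  by congr (_ + _); rewrite -mulrA mulrCA.
elim/malg_ind2: g => [|a g g' IH IH'|J].
- rewrite dmul0r mcoeff0 /pairing2 big1 // => p _.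
  by rewrite mcoeff0 !mulr0.
- rewrite [in LHS]dmulPr [LHS]mcoeffD mcoeffZ IH IH' /pairing2 mulr_sumr -big_split.
  apply: eq_bigr => p _ /=; rewrite mcoeffD mcoeffZ !mulrDr.
  by congr (_ + _); rewrite (mulrCA _ a) (mulrCA _ a).
by rewrite dmulU mcoeff_dmul_basis.
Qed.

Lemma pairing_dbasis I J : pairing (dbasis I) << FMonom J >> = (I == J)%:R.
Proof. by rewrite /pairing msuppU oner_eq0 big_seq_fset1 mcoeffUU mul1r mcoeffU. Qed.

Lemma linext_linext (K L : choiceType) (V : lmodType R) (h : L -> V)
  (k : K -> {malg R[L]}) x :
  linext h (linext k x) = linext (fun a => linext h (k a)) x.
Proof.
by rewrite [linext k x]/linext linext_sum; apply: eq_bigr => a _; rewrite linextZ.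
Qed.

Lemma eq_linext (K : choiceType) (V : lmodType R) (h k : K -> V) :
  h =1 k -> linext h =1 linext k.
Proof. by move=> hk x; apply: eq_bigr => a _; rewrite hk. Qed.

Lemma linext_mulr (K : choiceType) (c : R) (h : K -> R^o) x :
  c * linext h x = linext (V := R^o) (fun k => c * h k) x.
Proof. by rewrite /linext mulr_sumr; apply: eq_bigr => k _; rewrite /GRing.scale /= mulrCA. Qed.

Lemma linext_mull (K : choiceType) (c : R) (h : K -> R^o) x :
  linext h x * c = linext (V := R^o) (fun k => h k * c) x.
Proof. by rewrite /linext mulr_suml; apply: eq_bigr => k _; rewrite -scalerAl. Qed.

Lemma pairing_dmul f g x : pairing (dmul f g) x = pairing2 f g (LH_coprod x).
Proof.
rewrite pairing2E /LH_coprod linext_linext; apply: (eq_linext (V := R^o)) => -[K].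
by rewrite dmulP pairing2E LH_coprodU.
Qed.

Local Notation mon := word.
Local Notation mon2 := (pair_monom mon mon).
Local Notation mon3 := (pair_monom mon2 mon).

Lemma LH_coprodM x y : LH_coprod (x * y) = LH_coprod x * LH_coprod y.
Proof.
by apply: linextM => a b; rewrite /mmul /= fmmulE /= big_cat.
Qed.

Lemma LH_coprod1 : LH_coprod 1 = 1.
Proof. by rewrite /LH_coprod [in LHS]malg1U linextU fm1 big_nil. Qed.

Lemma LH_coprod_gen n :
  LH_coprod << gen n >> = \sum_(i < n.+1) << (gen i, gen (n - i)) >>.
Proof.
rewrite LH_coprodU; case: (insubP letter n) => [a _ <-|]; last first.
  rewrite -eqn0Ngt => /eqP ->.
  by rewrite big_ord_recl big_ord0 addr0 /gen insubF //= fm1 big_nil.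
by rewrite {1}/gen valK /= fmuE big_seq1.
Qed.

Lemma gen_ind (P : mon -> Prop) : P mone ->
  (forall n K, P K -> P (mmul (gen n) K)) -> forall K, P K.
Proof.
move=> P1 PM [K]; elim: K => [|a K IH]; first by rewrite -fmoneE.
have -> : FMonom (a :: K) = mmul (gen (val a)) (FMonom K); last exact: PM.
by rewrite /gen valK /mmul /= fmmulE fmuE.
Qed.

Definition coprod_l (p : mon2) : {malg R[mon3]} :=
  linext (fun q : mon2 => << (q, p.2) >>) (LH_coprod << p.1 >>).
Definition coprod_r (p : mon2) : {malg R[mon3]} :=
  linext (fun q : mon2 => << (p.1, q.1, q.2) >>) (LH_coprod << p.2 >>).

Lemma coprod_l1 : coprod_l mone = 1.
Proof. by rewrite /coprod_l /= LH_coprod1 [in LHS]malg1U linextU. Qed.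
Lemma coprod_r1 : coprod_r mone = 1.
Proof. by rewrite /coprod_r /= LH_coprod1 [in LHS]malg1U linextU. Qed.

Lemma coprod_lM p q : coprod_l (mmul p q) = coprod_l p * coprod_l q.
Proof.
rewrite /coprod_l /= -mulUU LH_coprodM.
by apply: linextM_gen => a b; rewrite mulUU.
Qed.

Lemma coprod_rM p q : coprod_r (mmul p q) = coprod_r p * coprod_r q.
Proof.
rewrite /coprod_r /= -mulUU LH_coprodM.
by apply: linextM_gen => a b; rewrite mulUU.
Qed.

Lemma sum_triple (V : zmodType) (F : nat -> nat -> nat -> V) n :
  \sum_(i < n.+1) \sum_(j < i.+1) F j (i - j)%N (n - i)%N =
  \sum_(i < n.+1) \sum_(j < (n - i).+1) F i j (n - i - j)%N.
Proof.
rewrite (eq_bigr (fun i : 'I_n.+1 => \sum_(j < n.+1 | (j <= i)%N)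
          F j (i - j)%N (n - i)%N)); last first.
  move=> i _; by rewrite (@big_ord_widen _ _ _ i.+1 n.+1 (fun j => F j (i - j)%N (n - i)%N)).
rewrite (exchange_big_dep xpredT) //=; apply: eq_bigr => i _.
have le_in : (i <= n)%N by rewrite -ltnS.
transitivity (\sum_(i <= k < n.+1) F i (k - i)%N (n - k)%N).
  by rewrite big_geq_mkord.
rewrite -{1}[val i]add0n big_addn subSn // big_mkord.
by apply: eq_bigr => j _; rewrite addnK addnC subnDA.
Qed.

Lemma eq_on_gen (A : nzRingType) (phi psi : leibniz_hopf -> A) :
  phi 1 = psi 1 -> {morph phi : x y / x * y} -> {morph psi : x y / x * y} ->
  (forall n, phi << gen n >> = psi << gen n >>) ->
  forall K, phi << K >> = psi << K >>.
Proof.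
move=> eq1 phiM psiM eqg; elim/gen_ind => [|n K IH]; first exact: eq1.
by rewrite -mulUU phiM psiM eqg IH.
Qed.

Lemma LH_coprodA K :
  linext coprod_l (LH_coprod << K >>) = linext coprod_r (LH_coprod << K >>).
Proof.
pose phi x := linext coprod_l (LH_coprod x).
pose psi x := linext coprod_r (LH_coprod x).
apply: (@eq_on_gen _ phi psi) => [|x y|x y|n].
- transitivity (1 : {malg R[mon3]}); rewrite /phi /psi LH_coprod1.
    exact: linext1 coprod_l1.
  exact/esym/(linext1 coprod_r1).
- rewrite /phi LH_coprodM; exact: linextM coprod_lM.
- rewrite /psi LH_coprodM; exact: linextM coprod_rM.
rewrite /phi /psi LH_coprod_gen.
pose F i j k : {malg R[mon3]} := << (gen i, gen j, gen k) >>.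
transitivity (\sum_(i < n.+1) \sum_(j < i.+1) F j (i - j)%N (n - i)%N).
  rewrite linext_sum; apply: eq_bigr => i _.
  rewrite linextU /coprod_l LH_coprod_gen linext_sum.
  by apply: eq_bigr => j _; rewrite linextU.
rewrite sum_triple linext_sum; apply: eq_bigr => i _.
rewrite linextU /coprod_r LH_coprod_gen linext_sum.
by apply: eq_bigr => j _; rewrite linextU.
Qed.

Definition coprod_swap (p : mon2) : {malg R[mon2]} := << (p.2, p.1) >>.

Lemma LH_coprodC K : linext coprod_swap (LH_coprod << K >>) = LH_coprod << K >>.
Proof.
have swapM p q : coprod_swap (mmul p q) = coprod_swap p * coprod_swap q.
  by rewrite mulUU.
pose phi x := linext coprod_swap (LH_coprod x).
apply: (@eq_on_gen _ phi LH_coprod) => [|x y|x y|n].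
- by rewrite /phi LH_coprod1; apply: linext1.
- rewrite /phi LH_coprodM; exact: linextM swapM.
- exact: LH_coprodM.
rewrite /phi LH_coprod_gen linext_sum (reindex_inj rev_ord_inj).
by apply: eq_bigr => i _; rewrite linextU /coprod_swap /= subSS subKn // -ltnS.
Qed.

Definition coprod_counit (p : mon2) : {malg R[mon]} :=
  if p.1 == mone then << p.2 >> else 0.

Lemma LH_coprod_counit K : linext coprod_counit (LH_coprod << K >>) = << K >>.
Proof.
have unitM p q : coprod_counit (mmul p q) = coprod_counit p * coprod_counit q.
  rewrite /coprod_counit.
  have -> : ((mmul p q).1 == mone) = (p.1 == mone) && (q.1 == mone).
    apply/eqP/andP => [/unitm [-> ->]//|[/eqP p1 /eqP q1]].
    by rewrite /mmul /= p1 q1 mul1m.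
  by do 2!case: (_ == mone); rewrite ?mul0r ?mulr0 // mulUU.
pose phi x := linext coprod_counit (LH_coprod x).
apply: (@eq_on_gen _ phi id) => [|x y|//|n].
- by rewrite /phi LH_coprod1; apply: linext1; rewrite /coprod_counit eqxx.
- rewrite /phi LH_coprodM; exact: linextM unitM.
rewrite /phi LH_coprod_gen linext_sum big_ord_recl big1 => [|i _].
  by rewrite addr0 linextU /coprod_counit /= {1}/gen insubF //= eqxx subn0.
rewrite linextU /coprod_counit /=; case: eqP => // /(congr1 (fun I : mon => wdeg I)).
by rewrite gen_deg /= /wdeg fm1 big_nil.
Qed.

Lemma dmulA : associative dmul.
Proof.
move=> f g h; apply: dual_ext => K; rewrite [LHS]dmulP [RHS]dmulP !pairing2E.
pose phi := linext (V := R^o) (fun p : mon3 =>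
  f@_(p.1.1 : seq letter) * g@_(p.1.2 : seq letter) * h@_(p.2 : seq letter)).
transitivity (phi (linext coprod_r (LH_coprod << FMonom K >>))).
  rewrite /phi linext_linext; apply: (eq_linext (V := R^o)) => -[[A] [B]].
  rewrite dmulP pairing2E /coprod_r [RHS]linext_linext linext_mulr.
  by apply: (eq_linext (V := R^o)) => q; rewrite linextU /= mulrA.
rewrite -LH_coprodA /phi linext_linext; apply: (eq_linext (V := R^o)) => -[[A] [B]].
rewrite dmulP pairing2E /coprod_l [LHS]linext_linext linext_mull.
by apply: (eq_linext (V := R^o)) => q; rewrite linextU.
Qed.

Lemma dmulC : commutative dmul.
Proof.
move=> f g; apply: dual_ext => K; rewrite [LHS]dmulP [RHS]dmulP !pairing2E.
rewrite -[in LHS]LH_coprodC [LHS]linext_linext.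
by apply: (eq_linext (V := R^o)) => p; rewrite linextU mulrC.
Qed.

Lemma dmul1l : left_id (dbasis [::]) dmul.
Proof.
move=> f; apply: dual_ext => K; rewrite dmulP.
pose ev := linext (V := R^o) (fun A : mon => f@_(A : seq letter)).
transitivity (ev << FMonom K >>); last by rewrite /ev linextU.
rewrite /ev -[in RHS]LH_coprod_counit [RHS]linext_linext pairing2E; apply: (eq_linext (V := R^o)) => -[A B] /=.
rewrite /dbasis mcoeffU /coprod_counit /mone /= fmoneE -val_eqE eq_sym /=.
by case: eqP => _; rewrite ?mul1r ?mul0r ?linextU ?linext0.
Qed.

Lemma dmulDl : left_distributive dmul +%R.
Proof. by move=> f g h; have := dmulPl 1 f g h; rewrite !scale1r. Qed.

Lemma dbasis_neq0 I : dbasis I != 0.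
Proof. by rewrite monalgU_eq0 oner_eq0. Qed.

HB.instance Definition _ := GRing.Zmodule_isComNzRing.Build LH_dual
  dmulA dmulC dmul1l dmulDl (dbasis_neq0 [::]).

Lemma dscaleAl a (f g : LH_dual) : a *: (f * g) = (a *: f) * g.
Proof. by have := dmulPl a f 0 g; rewrite dmul0l !addr0. Qed.

HB.instance Definition _ := GRing.Lmodule_isLalgebra.Build R LH_dual dscaleAl.
HB.instance Definition _ := GRing.Lalgebra_isComAlgebra.Build R LH_dual.

Definition dual_coprod : LH_dual -> {malg R[(seq letter * seq letter)%type]} :=
  linext (fun I => \sum_(i < (size I).+1) << (take i I, drop i I) >>).

Definition homogeneous (d : nat) (x : LH_dual) : Prop :=
  forall I : seq letter, I \in msupp x -> wdeg I = d.

(* The last clause is the condition "sum x' chi(x'') = 0": the left-hand side is the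
   image of dual_coprod x under x' \otimes x'' |-> x' * chi x''. *)
Definition is_conjugation (chi : LH_dual -> LH_dual) : Prop :=
  [/\ linear chi, chi 1 = 1 &
      forall d x, (0 < d)%N -> homogeneous d x ->
        linext (fun p => dbasis p.1 * chi (dbasis p.2)) (dual_coprod x) = 0].

Lemma dbasis_nil : dbasis [::] = 1. Proof. by []. Qed.

Lemma conv_dbasis (chi : LH_dual -> LH_dual) I :
  linext (fun p => dbasis p.1 * chi (dbasis p.2)) (dual_coprod (dbasis I)) =
  \sum_(i < (size I).+1) dbasis (take i I) * chi (dbasis (drop i I)).
Proof.
rewrite /dual_coprod linextU linext_sum.
by apply: eq_bigr => i _; rewrite linextU.
Qed.

Lemma wdeg_gt0 I : (0 < wdeg I)%N = (I != [::]).
Proof.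
case: I => [|a I]; first by rewrite /wdeg big_nil.
by rewrite /wdeg big_cons addn_gt0 (valP a).
Qed.

Lemma is_conjugationP chi : is_conjugation chi <->
  [/\ linear chi, chi 1 = 1 & forall I : seq letter, I != [::] ->
    \sum_(i < (size I).+1) dbasis (take i I) * chi (dbasis (drop i I)) = 0].
Proof.
split=> -[chiL chi1 chiP]; split=> //.
  move=> I nI; rewrite -conv_dbasis; apply: (chiP (wdeg I)); first by rewrite wdeg_gt0.
  by move=> J; rewrite msuppU oner_eq0 in_fset1 => /eqP ->.
move=> d x d0 hx; rewrite [LHS]linext_linext /linext big_seq big1 // => I Ix.
rewrite -[X in _ *: X]/(linext _ _) linext_sum.
rewrite (eq_bigr (fun i : 'I_(size I).+1 =>
  dbasis (take i I) * chi (dbasis (drop i I)))) => [|i _]; last by rewrite linextU.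
by rewrite chiP ?scaler0 // -wdeg_gt0 (hx _ Ix).
Qed.

Lemma conv_recl (chi : LH_dual -> LH_dual) (I : seq letter) :
  \sum_(i < (size I).+1) dbasis (take i I) * chi (dbasis (drop i I)) =
  chi (dbasis I) + \sum_(i < size I) dbasis (take i.+1 I) * chi (dbasis (drop i.+1 I)).
Proof. by rewrite big_ord_recl take0 drop0 dbasis_nil mul1r. Qed.

Lemma conjugation_unique chi chi' :
  is_conjugation chi -> is_conjugation chi' -> chi =1 chi'.
Proof.
move=> /is_conjugationP[L c1 P] /is_conjugationP[L' c1' P'].
have eqb I : chi (dbasis I) = chi' (dbasis I).
  have [n] := ubnP (size I); elim: n I => // n IH I; rewrite ltnS => leI.
  have [->|nI] := eqVneq I [::]; first by rewrite [LHS]c1 [RHS]c1'.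
  have := etrans (P I nI) (esym (P' I nI)).
  rewrite [LHS]conv_recl [RHS]conv_recl.
  have E (i : 'I_(size I)) : chi (dbasis (drop i.+1 I)) = chi' (dbasis (drop i.+1 I)).
    apply: IH; apply: leq_trans leI.
    by rewrite size_drop ltn_subrL (leq_ltn_trans _ (ltn_ord i)).
  rewrite [X in _ + X = _](_ : _ = \sum_(i < size I)
    dbasis (take i.+1 I) * chi' (dbasis (drop i.+1 I))) => [eqs|].
    exact: addIr eqs.
  by apply: eq_bigr => i _; exact: (congr1 ( *%R _) (E i)).
move=> x; elim/malg_ind2: x => [|a x y Hx Hy|I]; last exact: eqb.
  have e0 (f : LH_dual -> LH_dual) : linear f -> f 0 = 0.
    by move=> fL; have := fL (-1) 0 0; rewrite scaler0 addr0 scaleN1r addNr.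
  by rewrite (e0 chi L) (e0 chi' L').
by rewrite L L' Hx Hy.
Qed.

Fixpoint conj_word (n : nat) (I : seq letter) : LH_dual :=
  if n isn't m.+1 then 1 else
  if I is [::] then 1 else
  - \sum_(i < size I) dbasis (take i.+1 I) * conj_word m (drop i.+1 I).

Lemma conj_wordS n a I : conj_word n.+1 (a :: I) =
  - \sum_(i < (size I).+1) dbasis (take i.+1 (a :: I)) * conj_word n (drop i.+1 (a :: I)).
Proof. by []. Qed.

Lemma conj_word_nil n : conj_word n [::] = 1. Proof. by case: n. Qed.

Lemma eq_conj_word m n I :
  (size I <= m)%N -> (size I <= n)%N -> conj_word m I = conj_word n I.
Proof.
elim: m n I => [|m IH] n [|a I] lem; rewrite ?conj_word_nil //.
case: n => [|n] len; [by [] | rewrite !conj_wordS].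
have E (i : 'I_(size I).+1) :
    conj_word m (drop i.+1 (a :: I)) = conj_word n (drop i.+1 (a :: I)).
  by apply: IH; rewrite size_drop subSS (leq_trans (leq_subr _ _)).
apply: (congr1 -%R); apply: eq_bigr => i _.
exact: (congr1 ( *%R _) (E i)).
Qed.

Lemma conjugation_exists : exists chi, is_conjugation chi.
Proof.
pose chi := linext (fun I => conj_word (size I) I).
have chiU I : chi (dbasis I) = conj_word (size I) I by rewrite /chi linextU.
exists chi; apply/is_conjugationP; split=> [a x y||I nI].
- exact: linextP.
- by rewrite [LHS](chiU [::]).
rewrite conv_recl chiU.
case: I nI => // a I _; rewrite conj_wordS.
apply/eqP; rewrite addrC subr_eq0; apply/eqP/eq_bigr => i _.
by rewrite chiU; congr (_ * _); apply: eq_conj_word;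
  rewrite ?leqnn // size_drop subSS leq_subr.
Qed.

End LeibnizHopf.

Arguments dbasis {R} I.

(* Block partitions of I, given by their set {i_1 < ... < i_l} of cut positions:
   a subset of {1, ..., size I} that contains size I unless I is empty. *)
Definition cuts (T : eqType) (I : seq T) : {set {set 'I_(size I).+1}} :=
  [set c : {set 'I_(size I).+1} | (ord0 \notin c) && ((I != [::]) ==> (ord_max \in c))].

(* [:: beta(1); ...; beta(l)], where beta(k) consists of the terms of I at the
   (1-based) positions i_(k-1) + 1, ..., i_k, with i_0 = 0; enum lists c in
   increasing order. *)
Definition blocks (T : eqType) (I : seq T) (c : {set 'I_(size I).+1}) : seq (seq T) :=
  pairmap (fun i j => drop i (take j I)) 0%N [seq val k | k <- enum c].

Arguments cuts {T} I.
Arguments blocks {T} I c.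

(* Main.v *)
Require Import Defs.
From mathcomp Require Import all_boot all_algebra.

Import GRing.Theory.
Local Open Scope ring_scope.

(** The convolution identity defining the conjugation says that, for nonempty
    [I], the sum of [S_(take i I) * chi (S_(drop i I))] over [0 <= i <= size I]
    vanishes. Isolating the term [i = 0] and dropping the sign, which is
    harmless in characteristic 2, expresses [chi (S_I)] through the values of
    [chi] on the proper suffixes of [I] ([chi_dbasis_rec]).

    The sum over block partitions obeys the same recursion: a partition of a
    nonempty sequence is the choice of its first block together with a partition
    of what remains ([sum_cuts_rec]). Both sides are [1] on the empty sequence,
    so they agree by induction on the size.

    Since partitions are encoded by sets of cut positions, removing the first
    block [take j I] has to be read on these sets: discard the smallest cut [j]
    and translate the others by [-j] ([cons_cut] and [tail_cut]). The sets are
    compared through their increasing lists of positions. *)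

(** * Increasing lists of cut positions *)

Definition positions {n : nat} (c : {set 'I_n}) : seq nat :=
  [seq val k | k <- enum c].

Lemma positions_sorted n (c : {set 'I_n}) : sorted ltn (positions c).
Proof.
apply: (subseq_sorted ltn_trans) (iota_ltn_sorted 0 n).
by rewrite -val_enum_ord map_subseq // enumT filter_subseq.
Qed.

Lemma mem_positions n (c : {set 'I_n}) (k : 'I_n) :
  (val k \in positions c) = (k \in c).
Proof. by rewrite mem_map ?mem_enum //; apply: val_inj. Qed.

Lemma positionsP n (c : {set 'I_n}) (x : nat) :
  reflect (exists2 k : 'I_n, k \in c & x = k) (x \in positions c).
Proof.
apply: (iffP mapP) => -[k kc ->]; exists k => //; first by rewrite -mem_enum.
by rewrite mem_enum.
Qed.

Lemma head_positions_le n (c : {set 'I_n}) (k : 'I_n) :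
  k \in c -> (head 0 (positions c) <= k)%N.
Proof.
rewrite -mem_positions; have := positions_sorted _ c.
case: (positions c) => //= x s /(order_path_min ltn_trans)/allP lt_xs.
by rewrite in_cons => /predU1P[->|/lt_xs/ltnW].
Qed.

Lemma head_positions_mem n (c : {set 'I_n}) (k : 'I_n) :
  k \in c -> head 0 (positions c) \in positions c.
Proof. by rewrite -mem_positions; case: (positions c) => //= x s; rewrite mem_head. Qed.

(** * Adding and removing the first block *)

(** The cuts of a sequence of length [n] whose first block has length [j] and
    whose remaining blocks are those given by [c]. *)
Definition cons_cut (j : nat) {m : nat} (n : nat) (c : {set 'I_m.+1}) :
    {set 'I_n.+1} :=
  [set k : 'I_n.+1 | (k == j :> nat) || (j < k)%N && (inord (k - j) \in c)].

Definition tail_cut (j : nat) {n : nat} (m : nat) (c : {set 'I_n.+1}) :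
    {set 'I_m.+1} :=
  [set k : 'I_m.+1 | (0 < k)%N && (inord (j + k) \in c)].

(** [tail_cut] always discards position 0, so it undoes [cons_cut] exactly on
    the sets avoiding it. *)
Lemma cons_cutK j m n (c : {set 'I_m.+1}) :
  n = (j + m)%N -> (tail_cut j m (cons_cut j n c) == c) = (ord0 \notin c).
Proof.
move=> ->; apply/eqP/idP => [<-|c0]; first by rewrite inE.
apply/setP => k; rewrite !inE.
have [k0|k_gt0] := posnP k.
  by rewrite (_ : k = ord0) ?(negbTE c0) //; apply: val_inj.
have ltjm : (j + k < (j + m).+1)%N by rewrite ltnS leq_add2l -ltnS.
rewrite inordK // addKn inord_val.
have ltj : (j < j + k)%N by rewrite -[ltnLHS]addn0 ltn_add2l.
by rewrite ltj gtn_eqF.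
Qed.

Lemma tail_cutK j m n (c : {set 'I_n.+1}) : n = (j + m)%N -> (0 < j)%N ->
  c != set0 -> head 0%N (positions c) = j -> cons_cut j n (tail_cut j m c) = c.
Proof.
move=> nE j_gt0 /set0Pn[k0 k0c] hd; apply/setP => k; rewrite !inE.
case: (ltngtP k j) => /= [ltkj|ltjk|ekj].
- apply/esym/negbTE/negP => /head_positions_le; rewrite hd leqNgt ltkj //.
- have le_km : (k - j < m.+1)%N by rewrite ltnS leq_subLR -nE -ltnS.
  by rewrite inordK // subn_gt0 ltjk subnKC ?(ltnW ltjk) // inord_val.
- by rewrite -mem_positions /= ekj -hd (head_positions_mem _ _ _ k0c).
Qed.

(** Both lists are strictly increasing, so it suffices that they have the same
    elements. *)
Lemma positions_cons_cut j m n (c : {set 'I_m.+1}) :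
  n = (j + m)%N -> ord0 \notin c ->
  positions (cons_cut j n c) = j :: [seq (j + k)%N | k <- positions c].
Proof.
move=> -> c0.
apply: (irr_sorted_eq ltn_trans ltnn); first exact: positions_sorted.
  have c_gt0 : all (ltn 0) (positions c).
    apply/allP => _ /positionsP[k kc ->]; rewrite /= lt0n.
    by apply: contraNneq c0 => k0; rewrite (_ : ord0 = k) //; apply: val_inj.
  rewrite /= (path_sortedE ltn_trans) all_map sorted_map.
  apply/andP; split; last first.
    by apply: sub_sorted (positions_sorted _ c) => a b /=; rewrite ltn_add2l.
  apply: sub_all c_gt0 => k /= k_gt0.
  by rewrite -[ltnLHS]addn0 ltn_add2l.
move=> x; rewrite in_cons.
apply/positionsP/predU1P => [[k + ->]|].
  rewrite inE => /predU1P[->|/andP[ltjk kc]]; [by left | right].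
  apply/mapP; exists (k - j)%N; last by rewrite subnKC // ltnW.
  by rewrite -(inordK (_ : k - j < m.+1)%N) ?mem_positions // ltnS leq_subLR -ltnS.
case=> [->|/mapP[_ /positionsP[k kc ->] ->]].
  have lej : (j < (j + m).+1)%N by rewrite ltnS leq_addr.
  by exists (Ordinal lej); rewrite ?inE ?eqxx.
have ltk : (j + k < (j + m).+1)%N by rewrite ltnS leq_add2l -ltnS.
exists (Ordinal ltk) => //; rewrite inE /= addKn inord_val kc andbT.
by rewrite eq_sym -leq_eqVlt leq_addr.
Qed.

(** The blocks after a cut [j] only depend on [drop j I], with positions counted
    from [j]. *)
Lemma pairmap_blocks_shift {T : Type} (I : seq T) j (x : nat) (s : seq nat) :
  pairmap (fun a b => drop a (take b I)) (j + x)%N [seq (j + k)%N | k <- s] =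
  pairmap (fun a b => drop a (take b (drop j I))) x s.
Proof.
elim: s x => //= y s IH x; rewrite IH take_drop drop_drop.
by rewrite [(y + j)%N]addnC [(x + j)%N]addnC.
Qed.

Lemma blocks_cons_cut (T : eqType) (I : seq T) j
    (c : {set 'I_(size (drop j I)).+1}) : (j <= size I)%N -> ord0 \notin c ->
  blocks I (cons_cut j (size I) c) = take j I :: blocks (drop j I) c.
Proof.
move=> lej c0; rewrite /blocks -/(positions _) positions_cons_cut //=; last first.
  by rewrite size_drop subnKC.
by rewrite drop0 -[X in pairmap _ X]addn0 pairmap_blocks_shift.
Qed.

(** The final cut of [I] corresponds to the final cut of [drop j I], except when
    [j] is itself final: then [drop j I] is empty and [c] has to be empty. *)
Lemma cons_cut_in_cuts (T : eqType) (I : seq T) j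
    (c : {set 'I_(size (drop j I)).+1}) : (0 < j <= size I)%N ->
  (cons_cut j (size I) c \in cuts I) && (ord0 \notin c) = (c \in cuts (drop j I)).
Proof.
move=> /andP[j_gt0 lej]; rewrite !inE [0%N == j]eq_sym eqn0Ngt j_gt0 /= andbC.
congr (_ && _).
have -> : I != [::] by rewrite -size_eq0 -lt0n (leq_trans j_gt0).
have -> : (drop j I != [::]) = (j < size I)%N.
  by rewrite -size_eq0 size_drop subn_eq0 -ltnNge.
rewrite /= eq_sym eqn_leq lej /=.
case: ltnP => //= ltj; rewrite (_ : inord _ = ord_max) //.
by apply: val_inj; rewrite /= inordK size_drop.
Qed.

(** * The recursion for the sum over block partitions *)

Definition sum_cuts {T : eqType} {A : nzRingType} (w : seq T -> A) (I : seq T) : A :=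
  \sum_(c in cuts I) \prod_(B <- blocks I c) w B.

Lemma sum_cuts_nil (T : eqType) (A : nzRingType) (w : seq T -> A) :
  sum_cuts w [::] = 1.
Proof.
rewrite /sum_cuts (big_pred1 set0) => [|c]; first by rewrite /blocks enum_set0 big_nil.
rewrite !inE andbT; apply/idP/eqP => [c0|->]; last by rewrite inE.
by apply/setP => k; rewrite ord1 inE; apply: negbTE.
Qed.

Lemma head_positions_cuts (T : eqType) (I : seq T) (c : {set 'I_(size I).+1}) :
  I != [::] -> c \in cuts I -> (0 < head 0 (positions c) <= size I)%N.
Proof.
move=> nI; rewrite inE nI => /= /andP[c0 cmax].
rewrite (head_positions_le _ _ _ cmax) andbT.
have /positionsP[k kc ->] := head_positions_mem _ _ _ cmax.
rewrite lt0n; apply: contraNneq c0 => k0.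
by rewrite (_ : ord0 = k) //; apply: val_inj.
Qed.

(** Partitions are sorted according to the length of their first block, which
    is their smallest cut. *)
Lemma sum_cuts_rec (T : eqType) (A : nzRingType) (w : seq T -> A) (I : seq T) :
  I != [::] ->
  sum_cuts w I = \sum_(i < size I) w (take i.+1 I) * sum_cuts w (drop i.+1 I).
Proof.
move=> nI.
have sz_gt0 : (0 < size I)%N by rewrite lt0n size_eq0.
pose first (c : {set 'I_(size I).+1}) : 'I_(size I) :=
  (* Predecessor, because the term of index i has first block take i.+1 I. *)
  insubd (Ordinal sz_gt0) (head 0 (positions c)).-1.
have firstE c (i : 'I_(size I)) : c \in cuts I ->
    (first c == i) = (head 0%N (positions c) == i.+1).
  move=> /(head_positions_cuts _ _ _ nI)/andP[].
  rewrite -val_eqE val_insubd; case: (head _ _) => //= x _ ->.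
  by rewrite eqSS.
rewrite /sum_cuts (partition_big first xpredT) //=; apply: eq_bigr => i _.
have le_i : (0 < i.+1 <= size I)%N := ltn_ord i.
have szE : size I = (i.+1 + size (drop i.+1 I))%N by rewrite size_drop subnKC.
rewrite (reindex_onto (cons_cut i.+1 (size I))
           (tail_cut i.+1 (size (drop i.+1 I)))) => [|c /andP[cI]]; last first.
  rewrite firstE // => /eqP hd; apply: tail_cutK => //.
  apply: contraTneq cI => ->; rewrite !inE nI //.
rewrite big_distrr /=; apply: eq_big => [c|c].
  rewrite cons_cutK // andbAC cons_cut_in_cuts //.
  apply/andb_idr; rewrite -cons_cut_in_cuts // => /andP[cI c0].
  by rewrite firstE // positions_cons_cut.
rewrite cons_cutK // => /andP[_ c0].
by rewrite blocks_cons_cut // big_cons.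
Qed.

(** * The recursion for the conjugation *)

Lemma LH_dual_oppr (x : LH_dual 'F_2) : - x = x.
Proof.
apply/eqP; rewrite eq_sym -addr_eq0 -[x]scale1r -scalerDl.
by rewrite (_ : 1 + 1 = 0 :> 'F_2) ?scale0r //; apply/eqP.
Qed.

Lemma chi_dbasis_rec (chi : LH_dual 'F_2 -> LH_dual 'F_2) (I : seq letter) :
  is_conjugation chi -> I != [::] ->
  chi (dbasis I) =
    \sum_(i < size I) dbasis (take i.+1 I) * chi (dbasis (drop i.+1 I)).
Proof.
move=> /is_conjugationP[_ _ chiP] nI; have := chiP I nI; rewrite conv_recl.
by move/eqP; rewrite addr_eq0 LH_dual_oppr => /eqP.
Qed.

Theorem theorem5p5 (chi : LH_dual 'F_2 -> LH_dual 'F_2)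
    (hchi : is_conjugation chi) (I : seq letter) :
  chi (dbasis I) = \sum_(c in cuts I) \prod_(B <- blocks I c) dbasis B.
Proof.
change (chi (dbasis I) = sum_cuts dbasis I).
have [n] := ubnP (size I); elim: n I => // n IH I; rewrite ltnS => leI.
have [->|nI] := eqVneq I [::].
  by rewrite sum_cuts_nil; case: hchi.
rewrite (chi_dbasis_rec _ _ hchi nI) (sum_cuts_rec _ _ _ _ nI).
apply: eq_bigr => i _.
have IHi : chi (dbasis (drop i.+1 I)) = sum_cuts dbasis (drop i.+1 I).
  apply: IH; apply: leq_trans leI.
  by rewrite size_drop ltn_subrL (leq_ltn_trans _ (ltn_ord i)).
by rewrite IHi.
Qed.
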